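(* There is an infinite word over the alphabet $\{0,1,2\}$ that is rich and additive $4$-power-free.
   Context: A word over an alphabet $X$ (a nonempty finite set of letters; here $X\subseteq\mathbb{Z}$) is a finite or (one-sided) infinite sequence of letters from $X$. The length $|w|$ of a finite word $w$ is its number of letters, and its sum $\sum w$ is the sum (in $\mathbb{Z}$) of its letters, counted with multiplicity. The empty word $\varepsilon$ is the unique word of length $0$. A factor of a word $w$ is a finite word $y$ such that $w=xyz$ for some possibly empty words $x,z$ (contiguous subword). For an integer $k\ge 2$, an additive $k$-power is a word of the form $w_1w_2\cdots w_k$ where $w_1,\dots,w_k$ are nonempty finite words all having the same length and the same sum. A word is additive $k$-power-free if none of its factors is an additive $k$-power. A finite word is a palindrome if it equals its reversal (the empty word is a palindrome). A finite word of length $n$ is rich if it contains exactly $n+1$ distinct palindromes (including the empty word) as factors; an infinite word is rich if all of its finite factors are rich. *)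

(* Defs.v *)
From mathcomp Require Import all_boot all_algebra.

Set Implicit Arguments.
Unset Strict Implicit.
Unset Printing Implicit Defensive.

Import GRing.Theory.
Local Open Scope ring_scope.

(* Finite words are sequences (their factors are given by the library's [infix])
   and infinite words are functions from nat. *)
Definition infinite_word (T : Type) := nat -> T.

Definition inf_factor (T : Type) (w : infinite_word T) (y : seq T) : Prop :=
  exists m n : nat, y = mkseq (fun i => w (m + i)%N) n.

Definition palindrome (T : eqType) (u : seq T) : bool := rev u == u.

Definition factors (T : eqType) (u : seq T) : seq (seq T) :=
  undup [seq take n (drop m u) | m <- iota 0 (size u).+1, n <- iota 0 (size u).+1].

Lemma mem_factors (T : eqType) (u y : seq T) : (y \in factors u) = infix y u.
Proof.
rewrite mem_undup; apply/allpairsP/infixP => [[[m n] /= [_ _ ->]]|[x [z ->]]].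
  by exists (take m u), (drop n (drop m u)); rewrite !cat_take_drop.
exists (size x, size y); split.
- by rewrite -[_.1]/(size x) mem_iota add0n ltnS !size_cat leq_addr.
- by rewrite -[_.2]/(size y) mem_iota add0n ltnS !size_cat addnCA leq_addr.
- by rewrite /= drop_size_cat // take_size_cat.
Qed.

Definition rich (T : eqType) (u : seq T) : Prop :=
  size [seq y <- factors u | palindrome y] = (size u).+1.

Definition inf_rich (T : eqType) (w : infinite_word T) : Prop :=
  forall y : seq T, inf_factor w y -> rich y.

Definition word_sum (u : seq int) : int := \sum_(a <- u) a.

Definition additive_power (k : nat) (u : seq int) : Prop :=
  exists ws : k.-tuple (seq int),
    [/\ u = flatten ws,
        {in ws, forall v, v <> [::]} &
        {in ws &, forall v v', size v = size v' /\ word_sum v = word_sum v'}].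

Definition inf_additive_power_free (k : nat) (w : infinite_word int) : Prop :=
  forall y : seq int, inf_factor w y -> ~ additive_power k y.

(* Main.v *)
(* The word is the fixed point of 0 -> 10001, 1 -> 1012101, 2 -> 101222101. The
   images of letters are palindromes beginning with 10 and ending with 01, so the
   factor 11 occurs in the word exactly at the boundaries between two images.

   Richness amounts to complete returns to palindromes being palindromes. A
   palindrome v containing 11 parses as (rev t) f(u) t, with t a prefix of an
   image, and its occurrences correspond to those of u extended on both sides by
   any letter, by a nonzero letter, or by one fixed letter. So complete returns to
   v are obtained from complete returns to a shorter palindrome, provided that one
   treats at the same time the occurrences flanked by two nonzero letters.
   Palindromes without 11 are factors of single images, and their returns are short
   enough to be inspected inside f^3(ab) for the factors ab of length 2.

   Additive fourth powers are excluded by templates: five positions are described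
   by the letters found there and by the second differences of their coordinates
   (position, sum of the letters before it); in a fourth power these differences
   vanish. As |f(a)| = 5 + 2a and the sum of f(a) is 2 + 4a, f acts on coordinates
   by a matrix of determinant 16, so a template lifts through f to finitely many
   templates. The templates reachable from vanishing differences form a finite set,
   none of which is realised by distinct positions inside one image or in a factor 11;
   since positions get closer when one desubstitutes, none is realised at all. *)
Require Import Defs.
From mathcomp Require Import all_boot all_algebra.
From mathcomp Require Import zify ssrZ.
From Stdlib Require Import BinInt.

Set Implicit Arguments.
Unset Strict Implicit.
Unset Printing Implicit Defensive.

Local Open Scope nat_scope.

(** * Factors of an infinite word, addressed by position and length *)

Definition segment (T : Type) (w : infinite_word T) (i n : nat) : seq T :=
  [seq w k | k <- iota i n].

Section Segments.
Variables (T : Type) (w : infinite_word T).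

Lemma size_segment i n : size (segment w i n) = n.
Proof. by rewrite size_map size_iota. Qed.

Lemma nth_segment x0 i n k : k < n -> nth x0 (segment w i n) k = w (i + k).
Proof. by move=> lt_kn; rewrite (nth_map 0) ?size_iota // nth_iota. Qed.

Lemma segmentD i m n : segment w i (m + n) = segment w i m ++ segment w (i + m) n.
Proof. by rewrite /segment iotaD map_cat. Qed.

Lemma segmentS i n : segment w i n.+1 = w i :: segment w i.+1 n.
Proof. by []. Qed.

Lemma take_segment i m n : m <= n -> take m (segment w i n) = segment w i m.
Proof. by move=> /subnKC <-; rewrite segmentD take_size_cat ?size_segment. Qed.

Lemma drop_segment i m n : drop m (segment w i n) = segment w (i + m) (n - m).
Proof. by rewrite /segment -map_drop drop_iota addnC. Qed.

Lemma mkseq_segment i n : mkseq (fun k => w (i + k)) n = segment w i n.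
Proof. by rewrite /mkseq /segment -[in RHS](addn0 i) iotaDl -map_comp. Qed.

End Segments.

(** * The morphism, its fixed point and the boundaries between images *)

Definition block (a : nat) : seq nat :=
  match a with
  | 0 => [:: 1; 0; 0; 0; 1]
  | 1 => [:: 1; 0; 1; 2; 1; 0; 1]
  | _ => [:: 1; 0; 1; 2; 2; 2; 1; 0; 1]
  end.

Definition morph (u : seq nat) : seq nat := flatten [seq block a | a <- u].

Definition approx (k : nat) : seq nat := iter k morph [:: 1].

(** The iterates are prefixes of one another, since the image of 1 begins with 1, and [approx n] has
    more than [n] letters, so the default 0 is never read. *)
Definition word (n : nat) : nat := nth 0 (approx n) n.

Notation seg := (segment word).

(** As the word is fixed by [morph], this is where the image of its letter at position [j]
    begins. *)
Definition cut (j : nat) : nat := size (morph (seg 0 j)).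

Lemma morph_cat u v : morph (u ++ v) = morph u ++ morph v.
Proof. by rewrite /morph map_cat flatten_cat. Qed.

Lemma morph_cons a u : morph (a :: u) = block a ++ morph u.
Proof. by []. Qed.

Lemma prefix_morph u v : prefix u v -> prefix (morph u) (morph v).
Proof. by case/prefixP=> s ->; rewrite morph_cat prefix_prefix. Qed.

Lemma approx_prefixS k : prefix (approx k) (approx k.+1).
Proof. by elim: k => // k; apply: prefix_morph. Qed.

Lemma approx_prefix k l : k <= l -> prefix (approx k) (approx l).
Proof.
move=> /subnKC <-; elim: (l - k) => [|m IH]; first by rewrite addn0 prefix_refl.
by rewrite addnS (prefix_trans IH) // approx_prefixS.
Qed.

Lemma size_block_ge5 a : 5 <= size (block a).
Proof. by case: a => [|[]]. Qed.

Lemma size_morph_ge u : 5 * size u <= size (morph u).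
Proof.
elim: u => // a u IH; rewrite morph_cons size_cat /=.
have := size_block_ge5 a; lia.
Qed.

Lemma size_approx k : k < size (approx k).
Proof. by elim: k => // k IH; have := size_morph_ge (approx k); rewrite /=; lia. Qed.

Lemma nth_approx k n : n < size (approx k) -> nth 0 (approx k) n = word n.
Proof.
move=> lt_n; rewrite /word.
have nth_prefix (u v : seq nat) m :
  prefix u v -> m < size u -> nth 0 v m = nth 0 u m.
  by case/prefixP=> s -> lt_m; rewrite nth_cat lt_m.
rewrite -(nth_prefix _ _ _ (approx_prefix (leq_maxl k n))) //.
by rewrite (nth_prefix _ _ _ (approx_prefix (leq_maxr k n))) ?size_approx.
Qed.

Lemma approx_segment k : approx k = seg 0 (size (approx k)).
Proof.
apply: (@eq_from_nth _ 0) => [|n lt_n]; first by rewrite size_segment.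
by rewrite nth_segment // add0n nth_approx.
Qed.

(** This is the fixed point property: a prefix of [approx n] has as image a prefix of [approx n.+1],
    which is itself a prefix of the word. *)
Lemma segment_cut0 n : seg 0 (cut n) = morph (seg 0 n).
Proof.
have pre : prefix (morph (seg 0 n)) (approx n.+1).
  apply: (@prefix_morph _ (approx n)); rewrite [approx n]approx_segment.
  by rewrite -(subnKC (size_approx n)) addSnnS segmentD prefix_prefix.
have le_n : cut n <= size (approx n.+1) := size_prefix pre.
rewrite -(take_segment _ _ le_n) -approx_segment.
by have /prefixP [s ->] := pre; rewrite take_size_cat.
Qed.

Lemma cutD j n : cut (j + n) = cut j + size (morph (seg j n)).
Proof. by rewrite /cut segmentD morph_cat size_cat. Qed.

Lemma cutS j : cut j.+1 = cut j + size (block (word j)).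
Proof. by rewrite -addn1 cutD morph_cons cats0. Qed.

Lemma segment_cut j n : seg (cut j) (size (morph (seg j n))) = morph (seg j n).
Proof.
have := segment_cut0 (j + n); rewrite segmentD cutD segmentD morph_cat.
by rewrite segment_cut0 add0n => /eqP; rewrite eqseq_cat // eqxx => /eqP.
Qed.

Lemma segment_block j : seg (cut j) (size (block (word j))) = block (word j).
Proof. by have := segment_cut j 1; rewrite morph_cons cats0. Qed.

Lemma nth_block j c : c < size (block (word j)) ->
  nth 0 (block (word j)) c = word (cut j + c).
Proof. by move=> lt_c; rewrite -[in LHS]segment_block nth_segment. Qed.

Lemma leq_cut : {mono cut : i j / i <= j}.
Proof.
apply: leq_mono; apply: homo_ltn ltn_trans _ => j; rewrite cutS.
by have := size_block_ge5 (word j); lia.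
Qed.

Lemma cutP x : exists j c, x = cut j + c /\ c < size (block (word j)).
Proof.
elim: x => [|x [j [c [-> lt_c]]]]; first by exists 0, 0.
have [eq_c|lt_c1] := eqVneq c.+1 (size (block (word j))).
  exists j.+1, 0; rewrite cutS -eq_c; split; first by lia.
  by have := size_block_ge5 (word j.+1); lia.
by exists j, c.+1; rewrite addnS; split=> //; lia.
Qed.

Lemma word_lt3 i : word i < 3.
Proof.
have [j [c [-> lt_c]]] := cutP i; rewrite -nth_block //.
have /allP : all (gtn 3) (block (word j)) by case: (word j) => [|[]].
by apply; apply: mem_nth.
Qed.

Lemma seg_lt3 j n : all (gtn 3) (seg j n).
Proof. by apply/allP=> a /mapP [k _ ->]; apply: word_lt3. Qed.

Lemma word_cut j : word (cut j) = 1.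
Proof. by rewrite -[cut j]addn0 -nth_block; case: (word j) => [|[]]. Qed.

Lemma cut_gt0 j : 0 < j -> 1 < cut j.
Proof. by case: j => // j _; rewrite cutS; have := size_block_ge5 (word j); lia. Qed.

Lemma word_cut_pred j : 0 < j -> word (cut j).-1 = 1.
Proof.
case: j => // j _; have lt_c : (size (block (word j))).-1 < size (block (word j)).
  by case: (word j) => [|[]].
have := nth_block lt_c; rewrite cutS nth_last.
have -> : cut j + (size (block (word j))).-1 = (cut j + size (block (word j))).-1 by lia.
by move=> <-; case: (word j) => [|[]].
Qed.

Lemma cut_of_11 x : word x = 1 -> word x.+1 = 1 -> exists2 j, 0 < j & x.+1 = cut j.
Proof.
have [j [c [-> lt_c]]] := cutP x.
have [lt_c1|ge_c1] := ltnP c.+1 (size (block (word j))).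
  rewrite -addnS -!nth_block // => w_c w_c1; exfalso.
  (* No image contains 11, by inspection of all offsets. *)
  by move: (word j) c lt_c lt_c1 w_c w_c1 => [|[|a]] [|[|[|[|[|[|[|[|[|c]]]]]]]]].
by move=> _ _; exists j.+1 => //; rewrite cutS; lia.
Qed.

(** * Cutting palindromes at the factor 11 *)

Lemma rev_block a : rev (block a) = block a.
Proof. by case: a => [|[]]. Qed.

Lemma rev_morph u : rev (morph u) = morph (rev u).
Proof.
elim: u => // a u IH; rewrite morph_cons rev_cat IH rev_cons -cats1 morph_cat.
by rewrite morph_cons cats0 rev_block.
Qed.

Lemma morph_inj u v :
  all (gtn 3) u -> all (gtn 3) v -> morph u = morph v -> u = v.
Proof.
have sz a s : 0 < size (morph (a :: s)).
  by rewrite morph_cons size_cat (leq_trans _ (leq_addr _ _)) // (leq_trans _ (size_block_ge5 a)).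
elim: u v => [|a u IH] [|b v] //=.
- by move=> _ _ eq_m; have := sz b v; rewrite -eq_m.
- by move=> _ _ eq_m; have := sz a u; rewrite eq_m.
case/andP=> lt_a lt_u /andP [lt_b lt_v]; rewrite !morph_cons => eq_m.
have eq_ab : a = b by case: a b lt_a lt_b eq_m => [|[|[|?]]] [|[|[|?]]].
move: eq_m; rewrite eq_ab => /eqP; rewrite eqseq_cat // eqxx /= => /eqP.
by move/IH=> ->.
Qed.

Definition has11 (v : seq nat) : bool :=
  has (fun k => (nth 0 v k == 1) && (nth 0 v k.+1 == 1)) (iota 0 (size v)).

Lemma has11P v :
  reflect (exists k, nth 0 v k = 1 /\ nth 0 v k.+1 = 1) (has11 v).
Proof.
apply: (iffP hasP) => [[k _ /andP [/eqP ? /eqP ?]]|[k [v1 v2]]]; first by exists k.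
exists k; last by rewrite v1 v2.
by rewrite mem_iota /=; case: ltnP => // ge_k; rewrite nth_default in v1.
Qed.

Lemma has11_rev v : has11 (rev v) = has11 v.
Proof.
suff imp u : has11 u -> has11 (rev u) by apply/idP/idP => /imp; rewrite ?revK.
case/has11P=> k [v1 v2]; apply/has11P; exists (size u - k.+2).
have lt_k : k.+1 < size u by case: ltnP => // ge_k; rewrite nth_default in v2.
rewrite !nth_rev; try lia.
have -> : size u - (size u - k.+2).+1 = k.+1 by lia.
by have -> : size u - (size u - k.+2).+2 = k by lia.
Qed.

(** Cut inside the first occurrence of 11. Its mirror image is an occurrence too, so minimality
    keeps the two ends from overlapping and 11 out of [t]. The middle [m] is empty when this
    occurrence is central, hence the condition on [m ++ t]. *)
Lemma palindrome_split11 (v : seq nat) : palindrome v -> has11 v ->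
  exists t m : seq nat,
    [/\ v = rev t ++ m ++ t, nth 0 t 0 = 1, nth 0 (m ++ t) 0 = 1 & ~~ has11 t].
Proof.
move=> /eqP pal_v /has11P ex_k.
have {ex_k} ex_k : exists k, (nth 0 v k == 1) && (nth 0 v k.+1 == 1).
  by case: ex_k => k [v1 v2]; exists k; rewrite v1 v2.
case: (ex_minnP ex_k) => k /andP [/eqP v1 /eqP v2] min_k.
have lt_k : k.+1 < size v by case: ltnP => // ge_k; rewrite nth_default in v2.
have le_k : k.+1 <= size v - k.+1.
  have mirror l : l < size v -> nth 0 v (size v - l.+1) = nth 0 v l.
    by move=> lt_l; rewrite -{3}pal_v nth_rev.
  have := min_k (size v - k.+2); rewrite mirror //.
  have -> : (size v - k.+2).+1 = size v - k.+1 by lia.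
  by rewrite mirror ?v1 ?v2 // => [/(_ isT)|]; lia.
set s := take k.+1 v; have sz_s : size s = k.+1 by rewrite size_take lt_k.
have [m def_v] : exists m, v = s ++ m ++ rev s.
  exists (take (size v - k.+1 - k.+1) (drop k.+1 v)).
  rewrite -{1}[v](cat_take_drop k.+1); congr (_ ++ _).
  rewrite -{1}[drop _ _](cat_take_drop (size v - k.+1 - k.+1)); congr (_ ++ _).
  rewrite drop_drop subnK // /s -[in RHS]pal_v take_rev revK.
  by congr (drop _ _); lia.
exists (rev s), m; rewrite revK; split=> //.
- by rewrite nth_rev sz_s // subSS subn0 nth_take.
- have := v2; rewrite {1}def_v nth_cat sz_s ltnn subnn => <-.
  by [].
- rewrite has11_rev; apply/negP=> /has11P [l [s1 s2]].
  have lt_l : l.+1 < k.+1.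
    by rewrite -sz_s; case: ltnP => // ge_l; rewrite nth_default in s2.
  move: s1 s2; rewrite !nth_take //; last by lia.
  by move=> w1 w2; have := min_k l; rewrite w1 w2 => /(_ isT); lia.
Qed.

(** The flag serves the case where the flanks [t] exclude the letter 0 without separating 1 from 2.
    It rules out position 0, which has no left neighbour. *)
Definition occurs (b : bool) (v : seq nat) (i : nat) : bool :=
  (seg i (size v) == v) &&
  (b ==> [&& 0 < i, word i.-1 != 0 & word (i + size v) != 0]).

(* The default 1 is the first letter of the next image. *)
Definition extends (b : bool) (t : seq nat) (a : nat) : bool :=
  prefix t (block a) && (b ==> (nth 1 (block a) (size t) != 0)).

Lemma nth_block_default j c : c <= size (block (word j)) ->
  nth 1 (block (word j)) c = word (cut j + c).
Proof.
rewrite leq_eqVlt => /predU1P [->|lt_c].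
  by rewrite nth_default // -cutS word_cut.
by rewrite (set_nth_default 0) // nth_block.
Qed.

(** If [t] were longer than the image, it would run across the next boundary and contain 11. *)
Lemma prefix_block_at_cut t j : ~~ has11 t ->
  (seg (cut j) (size t) == t) = prefix t (block (word j)).
Proof.
move=> no11; have [le_t|lt_t] := leqP (size t) (size (block (word j))).
  by rewrite prefixE -[in RHS]segment_block take_segment // eq_sym.
rewrite prefixE take_oversize; last exact: ltnW.
have -> : (block (word j) == t) = false by apply/eqP=> eq_t; rewrite eq_t ltnn in lt_t.
apply/negP=> /eqP eq_t; case/has11P: no11.
exists (size (block (word j))).-1; rewrite prednK; last by have := size_block_ge5 (word j); lia.
rewrite -eq_t !nth_segment; try lia.
rewrite -cutS word_cut; split=> //.
rewrite -(@word_cut_pred j.+1) // cutS; congr word.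
by have := size_block_ge5 (word j); lia.
Qed.

Lemma prefix_block_before_cut t j : ~~ has11 t -> size t <= cut j.+1 ->
  (seg (cut j.+1 - size t) (size t) == rev t) = prefix t (block (word j)).
Proof.
move=> no11 le_tj; have [le_t|lt_t] := leqP (size t) (size (block (word j))).
  rewrite prefixE -[in RHS]rev_block take_rev -(inj_eq (can_inj revK)) revK.
  congr (_ == _); rewrite -[in RHS]segment_block drop_segment size_segment.
  by rewrite subKn // cutS addnBA.
rewrite prefixE take_oversize; last exact: ltnW.
have -> : (block (word j) == t) = false by apply/eqP=> eq_t; rewrite eq_t ltnn in lt_t.
apply/negP=> /eqP eq_t; case/negP: no11; rewrite -has11_rev.
apply/has11P; exists (size t - (size (block (word j))).+1).
have ge5 := size_block_ge5 (word j); rewrite -eq_t !nth_segment; try lia.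
have -> : cut j.+1 - size t + (size t - (size (block (word j))).+1) = (cut j).-1.
  by rewrite cutS in le_tj *; lia.
have -> : cut j.+1 - size t + (size t - (size (block (word j))).+1).+1 = cut j.
  by rewrite cutS in le_tj *; lia.
rewrite word_cut word_cut_pred //.
(* For [j = 0] no boundary precedes the image, but then [le_tj] contradicts [lt_t]. *)
by case: j {eq_t ge5} le_tj lt_t => //; rewrite cutS -[cut 0]/0; lia.
Qed.

Lemma nth_block_before j c : c <= size (block (word j)) -> c < cut j.+1 ->
  nth 1 (block (word j)) c = word (cut j.+1 - c).-1.
Proof.
rewrite leq_eqVlt cutS => /predU1P [-> lt_c|lt_c _].
  rewrite nth_default // addnK word_cut_pred //.
  by case: j lt_c => // ; rewrite -[cut 0]/0 ltnn.
rewrite (set_nth_default 0) // -{1}rev_block nth_rev // nth_block; last by lia.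
by congr word; lia.
Qed.

(** The letters meeting at either end of [m] form 11, so both ends are boundaries and [m] is the
    image of the letters between them; the flanks then lie in the two neighbouring images. *)
Lemma occurs_parse b (t m : seq nat) i :
  nth 0 t 0 = 1 -> nth 0 (m ++ t) 0 = 1 -> ~~ has11 t -> palindrome m ->
  occurs b (rev t ++ m ++ t) i ->
  exists j n, [/\ 0 < j, i + size t = cut j, m = morph (seg j n),
    extends b t (word j.-1) & extends b t (word (j + n))].
Proof.
move=> t1 mt1 no11 /eqP pal_m /andP [/eqP]; rewrite !size_cat size_rev !segmentD.
move=> /eqP; rewrite !eqseq_cat ?size_rev ?size_segment //.
move=> /and3P [/eqP eq_s /eqP eq_m /eqP eq_t] flag.
have t_gt0 : 0 < size t by case: (t) t1.
have before : word (i + size t).-1 = 1.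
  have := congr1 (fun u => nth 0 u (size t).-1) eq_s.
  rewrite /= nth_segment; last by lia.
  rewrite nth_rev; last by lia.
  have -> : size t - (size t).-1.+1 = 0 by lia.
  by rewrite t1 => <-; congr word; lia.
have after : word (i + size t) = 1.
  have : nth 0 (seg (i + size t) (size m + size t)) 0 = 1 by rewrite segmentD eq_m eq_t.
  by rewrite nth_segment ?addn0 //; lia.
have [||j j_gt0 def_j] := @cut_of_11 (i + size t).-1; rewrite ?prednK //; try lia.
have {}def_j : i + size t = cut j by lia.
have before2 : word (i + size t + size m).-1 = 1.
  (* For empty [m] the two seams coincide; otherwise the palindrome [m] ends with its first letter,
     which is 1. *)
  have [->|m_gt0] := posnP (size m); first by rewrite addn0.
  have last_m : nth 0 (rev m) (size m).-1 = nth 0 m 0 by rewrite nth_rev ?prednK ?subnn.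
  move: mt1; rewrite nth_cat m_gt0 -last_m pal_m => <-.
  rewrite -[X in nth 0 X]eq_m nth_segment; last by lia.
  by congr word; lia.
have after2 : word (i + size t + size m) = 1.
  by rewrite -t1 -[X in _ = nth 0 X _]eq_t nth_segment ?addn0.
have [||k k_gt0 def_k] := @cut_of_11 (i + size t + size m).-1; rewrite ?prednK //; try lia.
have {}def_k : i + size t + size m = cut k by lia.
have le_jk : j <= k by rewrite -leq_cut -def_k def_j leq_addr.
exists j, (k - j); have def_k2 : cut k = cut j + size (morph (seg j (k - j))).
  by rewrite -cutD subnKC.
have sz_m : size m = size (morph (seg j (k - j))) by lia.
rewrite subnKC //.
have pre2 : prefix t (block (word k)).
  by rewrite -prefix_block_at_cut // -def_k eq_t.
have pre1 : prefix t (block (word j.-1)).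
  rewrite -prefix_block_before_cut ?prednK // -?def_j ?leq_addl // addnK.
  by rewrite eq_s.
have le2 : size t <= size (block (word k)) := size_prefix pre2.
have le1 : size t <= size (block (word j.-1)) := size_prefix pre1.
split=> //; first by rewrite -segment_cut -sz_m -def_j.
- rewrite /extends pre1; apply/implyP=> b_true.
  move: flag; rewrite b_true /= => /and3P [i_gt0 w_i _].
  rewrite nth_block_before ?prednK // -?def_j ?addnK //.
  by lia.
- rewrite /extends pre2; apply/implyP=> b_true.
  move: flag; rewrite b_true /= => /and3P [_ _].
  by rewrite nth_block_default // -def_k !addnA.
Qed.

Lemma occurs_unparse b (t u : seq nat) j :
  0 < j -> seg j (size u) = u -> ~~ has11 t ->
  extends b t (word j.-1) -> extends b t (word (j + size u)) ->
  size t <= cut j /\ (0 < cut j - size t -> occurs b (rev t ++ morph u ++ t) (cut j - size t)).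
Proof.
move=> j_gt0 def_u no11 /andP [pre1 b1] /andP [pre2 b2].
have le2 : size t <= size (block (word (j + size u))) := size_prefix pre2.
have le1 : size t <= size (block (word j.-1)) := size_prefix pre1.
have le_tj : size t <= cut j by rewrite -(prednK j_gt0) cutS; lia.
split=> // i_gt0; rewrite /occurs !size_cat size_rev !segmentD subnK //.
have eq_m := segment_cut j (size u); have eq_cut := cutD j (size u).
rewrite def_u in eq_m eq_cut; rewrite eq_m -eq_cut.
move: pre1; rewrite -prefix_block_before_cut ?prednK // => /eqP ->.
move: pre2; rewrite -prefix_block_at_cut // => /eqP ->.
rewrite eqxx i_gt0 /=; apply/implyP => b_true; rewrite b_true /= in b1 b2.
rewrite nth_block_before ?prednK // in b1; last by lia.
by rewrite nth_block_default // in b2; rewrite b1 addnA subnK // addnA -eq_cut.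
Qed.

(** The images branch only after 10, where 0 parts from 1 and 2, and after 1012, where 1 parts from
    2. Since [t] is a prefix of [block a] fixed by its length, finitely many cases remain, settled
    by computation. *)
Lemma extends_cases b (t : seq nat) a : nth 0 t 0 = 1 -> a < 3 -> extends b t a ->
  [\/ forall c, c < 3 -> extends b t c,
      forall c, c < 3 -> extends b t c = (c != 0) |
      forall c, c < 3 -> extends b t c = (c == a)].
Proof.
move=> t1 lt_a ext_a; have /andP [pre_t _] := ext_a.
pose letters := [:: 0; 1; 2].
pose check b t a := [|| all (extends b t) letters,
  all (fun c => extends b t c == (c != 0)) letters |
  all (fun c => extends b t c == (c == a)) letters].
have in_letters c : c < 3 -> c \in letters by case: c => [|[|[|]]].
have : check b t a.
  have t_gt0 : 0 < size t by case: (t) t1.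
  have le_t : size t <= size (block a) := size_prefix pre_t.
  have def_t : t = take (size t) (block a) by apply/esym/eqP; rewrite -prefixE.
  move: ext_a; rewrite def_t.
  have : all (fun a => all (fun n => all (fun b =>
     let t := take n (block a) in extends b t a ==> check b t a) [:: true; false])
     (iota 1 (size (block a)))) letters by vm_compute.
  move/allP/(_ _ (in_letters _ lt_a))/allP/(_ (size t)).
  rewrite mem_iota t_gt0 add1n ltnS le_t => /(_ isT)/allP/(_ b).
  by rewrite !inE; case: (b) => /(_ isT)/implyP.
case/or3P=> /allP chk; [apply: Or31|apply: Or32|apply: Or33] => c /in_letters /chk //;
 by move/eqP.
Qed.

Definition consecutive (P : pred nat) (i i' : nat) : Prop :=
  [/\ i < i', P i, P i' & forall k, i < k < i' -> ~~ P k].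

Lemma palindrome_cat3 (t u : seq nat) : palindrome (rev t ++ u ++ t) = palindrome u.
Proof.
rewrite /palindrome !rev_cat revK -catA.
by rewrite eqseq_cat // eqxx eqseq_cat ?size_rev // eqxx andbT.
Qed.

Lemma palindrome_morph (u : seq nat) : all (gtn 3) u -> palindrome (morph u) = palindrome u.
Proof.
move=> lt_u; rewrite /palindrome rev_morph; apply/eqP/eqP=> [|-> //].
by apply: morph_inj; rewrite ?all_rev.
Qed.

(** * Palindromes without the factor 11 *)

Lemma iter_cut k j n :
  seg (iter k cut j) (size (iter k morph (seg j n))) = iter k morph (seg j n) /\
  iter k cut (j + n) = iter k cut j + size (iter k morph (seg j n)).
Proof.
elim: k => [|k [IHs IHc]] /=; first by rewrite !size_segment.
have := segment_cut (iter k cut j) (size (iter k morph (seg j n))).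
by rewrite IHc cutD IHs.
Qed.

Lemma iter_cutP k x : exists2 j, iter k cut j <= x & x < iter k cut j.+1.
Proof.
elim: k x => [|k IH] x; first by exists x => /=.
have [y [c [-> lt_c]]] := cutP x; have [j le_j lt_j] := IH y.
exists j => /=; first by rewrite (leq_trans _ (leq_addr _ _)) // leq_cut.
by rewrite (@leq_trans (cut y.+1)) ?leq_cut // cutS ltn_add2l.
Qed.

Definition word_pairs : seq (nat * nat) :=
  [:: (0, 0); (0, 1); (1, 0); (1, 1); (1, 2); (2, 1); (2, 2)].

Lemma word_pairsP j : (word j, word j.+1) \in word_pairs.
Proof.
have [q [c [-> lt_c]]] := cutP j.
have [lt_c1|ge_c1] := ltnP c.+1 (size (block (word q))).
  rewrite -addnS -!nth_block //.
  by move: (word q) c lt_c lt_c1 => [|[|a]] [|[|[|[|[|[|[|[|[|c]]]]]]]]].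
have -> : (cut q + c).+1 = cut q.+1 by rewrite cutS; lia.
have -> : cut q + c = (cut q.+1).-1 by rewrite cutS; lia.
by rewrite word_cut word_cut_pred.
Qed.

(** The longest image has 9 letters, which bounds the offsets and the lengths. *)
Definition short_factors : seq (seq nat) :=
  let suffixes := [seq drop c (block a) | c <- iota 0 9, a <- [:: 0; 1; 2]] in
  undup [seq v <- [seq take n u | n <- iota 0 10, u <- suffixes] | palindrome v].

(* Here and below [if] replaces [==>] and [&&], both of whose arguments
   [vm_compute] would evaluate. *)
Definition occurs_in (z : seq nat) (b : bool) (v : seq nat) (r : nat) : bool :=
  if take (size v) (drop r z) == v then
    if b then (nth 0 z r.-1 != 0) && (nth 0 z (r + size v) != 0) else true
  else false.

(** Here [r'] is the next occurrence after [r]. The bound on [r' + size v] fails if the search finds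
    nothing, and leaves room for the right neighbour. *)
Definition returns_ok (m : nat) (z : seq nat) (b : bool) (v : seq nat) : bool :=
  all (fun r => if occurs_in z b v r then
      let r' := r.+1 + find (occurs_in z b v) (iota r.+1 (size z)) in
      (r' + size v < size z) && palindrome (take (r' - r + size v) (drop r z))
    else true) (iota 1 m).

(* Images end with 1, so 1 is the letter before every boundary except the one at 0. *)
Definition window a b := 1 :: iter 3 morph [:: a; b].

Definition cut3 j := iter 3 cut j.

Arguments window : simpl never.
Arguments cut3 : simpl never.

(** Positions 1 to [m] cover the threefold image of the first letter. As 9 bounds the size of [v],
    an occurrence starting there lies in the window with its right neighbour. *)
Definition check_windows : bool :=
  all (fun p => let m := size (iter 3 morph [:: p.1]) in let z := window p.1 p.2 in
    (m + 9 < size z) &&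
    all (fun v => returns_ok m z true v && returns_ok m z false v) short_factors)
  word_pairs.

Lemma check_windowsT : check_windows.
Proof. by vm_cast_no_check (erefl true). Qed.

(** A factor with letters on both sides of a boundary contains 11, so [v] lies inside one image. *)
Lemma short_factorsP (v : seq nat) i : palindrome v -> ~~ has11 v ->
  seg i (size v) = v -> v \in short_factors /\ size v <= 9.
Proof.
move=> pal_v no11 def_v; have [j [c [def_i lt_c]]] := cutP i; subst i.
have sz9 a : size (block a) <= 9 by case: a => [|[]].
have le_cv : c + size v <= size (block (word j)).
  rewrite leqNgt; apply: contra no11 => lt_cv; apply/has11P.
  have [l def_l] : exists l, size (block (word j)) = c + l.+1.
    by exists (size (block (word j)) - c.+1); lia.
  have def_S : cut j.+1 = (cut j + c + l).+1 by rewrite cutS def_l; lia.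
  exists l; rewrite -def_v !nth_segment; try lia.
  have -> : cut j + c + l.+1 = cut j.+1 by rewrite def_S addnS.
  have -> : cut j + c + l = (cut j.+1).-1 by rewrite def_S.
  by rewrite word_cut word_cut_pred.
have := sz9 (word j) => le9.
have le_v : size v <= 9 by lia.
split=> //; rewrite mem_undup mem_filter pal_v andTb.
have -> : v = take (size v) (drop c (block (word j))).
  by rewrite -segment_block drop_segment take_segment //; lia.
apply/allpairsP; exists (size v, drop c (block (word j))); split=> //.
  by rewrite -[_ \in _]/(size v \in iota 0 10) mem_iota; lia.
apply/allpairsP; exists (c, word j); split=> //.
  by rewrite -[_ \in _]/(c \in iota 0 9) mem_iota; lia.
by have := word_lt3 j; rewrite -[_.2]/(word j); case: (word j) => [|[|[]]].
Qed.

Lemma nth_window j k (N := size (iter 3 morph [:: word j; word j.+1])) :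
  k < N -> nth 0 (window (word j) (word j.+1)) k.+1 = word (cut3 j + k).
Proof.
have [eq_z _] := iter_cut 3 j 2; move=> lt_k.
by rewrite /window -[nth _ _ _]/(nth 0 (iter 3 morph (seg j 2)) k) -eq_z nth_segment.
Qed.

Lemma drop_window j k (N := size (iter 3 morph [:: word j; word j.+1])) :
  drop k.+1 (window (word j) (word j.+1)) = seg (cut3 j + k) (N - k).
Proof.
have [eq_z _] := iter_cut 3 j 2; rewrite -/(cut3 j) in eq_z.
by rewrite /window -[drop _ _]/(drop k (iter 3 morph (seg j 2))) -eq_z drop_segment.
Qed.

Lemma size_window a b : size (window a b) = (size (iter 3 morph [:: a; b])).+1.
Proof. by []. Qed.

Lemma occurs_inE z b (v : seq nat) r : occurs_in z b v r =
  (take (size v) (drop r z) == v) &&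
  (b ==> (nth 0 z r.-1 != 0) && (nth 0 z (r + size v) != 0)).
Proof. by rewrite /occurs_in; case: (_ == _) => //; case: b. Qed.

Lemma occurs_in_window j b (v : seq nat) k :
  k.+1 + size v < size (window (word j) (word j.+1)) -> 0 < cut3 j + k ->
  occurs_in (window (word j) (word j.+1)) b v k.+1 = occurs b v (cut3 j + k).
Proof.
rewrite size_window ltnS => lt_k pos.
rewrite occurs_inE /occurs drop_window take_segment; last by lia.
congr (_ && (_ ==> _)); rewrite pos andTb addSn nth_window ?addnA; last by lia.
congr ((_ != 0) && _); rewrite -[k.+1.-1]/k.
case: k lt_k pos => [|k] lt_k pos; last by rewrite nth_window ?addnS //; lia.
rewrite addn0 in pos *; rewrite word_cut_pred //.
by case: (j) pos => // j' _; rewrite -[0]/(iter 2 cut 0) ltnNge !leq_cut.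
Qed.

Lemma short_returns b (v : seq nat) i i' : palindrome v -> ~~ has11 v ->
  consecutive (occurs b v) i i' -> palindrome (seg i (i' - i + size v)).
Proof.
move=> pal_v no11 [lt_ii occ_i occ_i' none].
have [v_short le_v] : v \in short_factors /\ size v <= 9.
  by apply: (@short_factorsP v i) => //; case/andP: occ_i => /eqP.
have [j le_j lt_j] := iter_cutP 3 i; rewrite -!/(cut3 _) in le_j lt_j.
pose m := size (iter 3 morph [:: word j]).
have [z def_z] : exists z, z = window (word j) (word j.+1) by eexists.
have [_ cut_j] := iter_cut 3 j 1; rewrite addn1 -/m -!/(cut3 _) in cut_j.
have /allP/(_ _ (word_pairsP j))/andP [lt_z /allP/(_ _ v_short) ok_v] := check_windowsT.
have {}ok_v : returns_ok m z b v by rewrite def_z; case/andP: ok_v; case: (b).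
have {}lt_z : m + 9 < size z by rewrite def_z.
have sz_z : size z = (size (iter 3 morph [:: word j; word j.+1])).+1 by rewrite def_z.
have [r def_i] : exists r, i = cut3 j + r by exists (i - cut3 j); rewrite subnKC.
have lt_r : r < m by rewrite def_i cut_j ltn_add2l in lt_j.
have [s def_i'] : exists s, i' = cut3 j + s.
  by exists (i' - cut3 j); rewrite subnKC // (leq_trans le_j) // ltnW.
have lt_rs : r < s by rewrite def_i def_i' ltn_add2l in lt_ii.
have occ_r : occurs_in z b v r.+1.
  (* At position 0 the leading 1 of the window has no counterpart in the word; there [occ_i] forces
     [b] to be false and no neighbour is consulted. *)
  have [pos|pos] := posnP i; last first.
    by rewrite def_z occurs_in_window -?def_z -?def_i //; clear -lt_z lt_r le_v; lia.
  move: occ_i; rewrite /occurs pos /= implybF => /andP [/eqP eq_v /negbTE ->].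
  rewrite occurs_inE def_z drop_window -def_i pos take_segment ?eq_v ?eqxx //.
  by rewrite sz_z in lt_z; lia.
have r_in : r.+1 \in iota 1 m by rewrite mem_iota !ltnS.
have := allP ok_v _ r_in; rewrite occ_r.
set q := find _ _ => /andP [lt_q pal_q].
have lt_q' : q < size z by clear -lt_q; lia.
have occ_q : occurs_in z b v (r.+2 + q).
  have := @nth_find _ 0 (occurs_in z b v) (iota r.+2 (size z)).
  by rewrite has_find size_iota -/q nth_iota // => /(_ lt_q').
rewrite addSn def_z occurs_in_window -?addSn -?def_z // in occ_q; last by lia.
(* The occurrence found in the window is [i']: none lies strictly between [i] and [i'], and [find]
   stops at the first one. *)
have le_sq : s <= r.+1 + q.
  rewrite leqNgt; apply/negP=> lt_qs.
  have := none (cut3 j + (r.+1 + q)); rewrite occ_q => H.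
  by suff: false by []; apply: H; rewrite def_i def_i' !ltn_add2l lt_qs andbT; lia.
have [p def_s] : exists p, s = r.+1 + p by exists (s - r.+1); lia.
have le_qp : q <= p.
  rewrite leqNgt; apply/negP=> lt_pq.
  have := @before_find _ 0 (occurs_in z b v) (iota r.+2 (size z)) p lt_pq.
  rewrite nth_iota; last exact: ltn_trans lt_q'.
  rewrite addSn def_z occurs_in_window -?def_z -?def_s -?def_i' ?occ_i' //; lia.
have eq_pq : p = q by clear -le_sq le_qp def_s; lia.
move: pal_q; rewrite def_z drop_window take_segment -?def_i.
  by congr (is_true (palindrome (seg i _))); clear -def_i def_i' def_s eq_pq; lia.
by rewrite sz_z in lt_q; clear -lt_q; lia.
Qed.

(** * Complete returns and richness *)

(** Induction on the length of [v]. When [v] contains 11, its return desubstitutes to a return to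
    [seg j k], and [extends_cases] tells which occurrences of [seg j k] lift back to occurrences of
    [v]. *)
Theorem palindromic_returns b (v : seq nat) i i' : palindrome v ->
  consecutive (occurs b v) i i' -> palindrome (seg i (i' - i + size v)).
Proof.
have [n le_n] := ubnP (size v); elim: n => // n IH in v le_n b i i' *.
move=> pal_v ret; have [h11|no11] := boolP (has11 v); last exact: short_returns ret.
have [t [m [def_v t1 mt1 no11]]] := palindrome_split11 pal_v h11.
have pal_m : palindrome m by move: pal_v; rewrite def_v palindrome_cat3.
have [lt_ii occ_i occ_i' none] := ret.
rewrite def_v in occ_i occ_i'.
have [j [k [j_gt0 def_j def_m ext1 ext2]]] := occurs_parse t1 mt1 no11 pal_m occ_i.
have [j' [k' [j'_gt0 def_j' def_m' ext1' ext2']]] := occurs_parse t1 mt1 no11 pal_m occ_i'.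
have eq_u : seg j k = seg j' k' by apply: morph_inj; rewrite ?seg_lt3 // -def_m.
have eq_k : k' = k by rewrite -(size_segment word j k) eq_u size_segment.
subst k'; have lt_jj : j < j' by rewrite ltnNge -leq_cut -def_j -def_j' leq_add2r -ltnNge.
have pal_u : palindrome (seg j k) by rewrite -palindrome_morph ?seg_lt3 // -def_m.
(* Such an [x] would lift to an occurrence of [v] strictly between [i] and [i']. *)
have between x : j < x < j' -> seg x k = seg j k ->
    ~~ (extends b t (word x.-1) && extends b t (word (x + k))).
  move=> /andP [lt_jx lt_xj] eq_x; apply/negP=> /andP [e1 e2].
  have := @occurs_unparse b t (seg j k) x; rewrite size_segment eq_x.
  case=> // [|le_tx occ_x]; first exact: leq_ltn_trans lt_jx.
  have in_x : i < cut x - size t < i'.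
    have lt_cx : cut j < cut x by rewrite ltnNge leq_cut -ltnNge.
    have lt_cx' : cut x < cut j' by rewrite ltnNge leq_cut -ltnNge.
    by rewrite ltn_subRL addnC def_j lt_cx ltn_subLR // addnC def_j'.
  have := none _ in_x; rewrite def_v def_m occ_x //.
  by case/andP: in_x => lt_ix _; apply: leq_ltn_trans lt_ix.
have sz_v : 2 * size t + 5 * k <= size v.
  rewrite def_v !size_cat size_rev def_m.
  by have := size_morph_ge (seg j k); rewrite size_segment; lia.
have t_gt0 : 0 < size t by case: (t) t1.
have lt_k : k < n by clear -sz_v t_gt0 le_n; lia.
(* The return to [v] is the image of [seg j (j' - j + k)] between [rev t] and [t]. *)
suff pal_j : palindrome (seg j (j' - j + k)).
  have -> : seg i (i' - i + size v) = rev t ++ morph (seg j (j' - j + k)) ++ t.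
    have sz_m : size m = size (morph (seg j' k)) by rewrite -def_m'.
    have cut_k := cutD j' k; rewrite -sz_m in cut_k.
    have [q def_q] : exists q, j' = j + q by exists (j' - j); rewrite subnKC // ltnW.
    have cut_q := cutD j (q + k); rewrite addnA -def_q in cut_q.
    have -> : i' - i + size v = size t + (size (morph (seg j (q + k))) + size t).
      by rewrite def_v !size_cat size_rev; clear -def_j def_j' cut_k cut_q lt_ii; lia.
    have -> : j' - j + k = q + k by rewrite def_q addKn.
    rewrite (segmentD word i) def_j (segmentD word (cut j)) segment_cut -cut_q cut_k -def_j'.
    move: occ_i occ_i' => /andP [/eqP eq_i _] /andP [/eqP eq_i' _]; move: eq_i eq_i'.
    rewrite !size_cat size_rev !segmentD => /eqP; rewrite eqseq_cat ?size_segment ?size_rev //.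
    case/andP=> /eqP -> _ /eqP; rewrite !eqseq_cat ?size_segment ?size_rev //.
    by case/and3P=> _ _ /eqP ->.
  by rewrite palindrome_cat3 palindrome_morph ?seg_lt3.
have [all_ext|nz_ext|one_ext] := extends_cases t1 (word_lt3 _) ext1.
- rewrite -[k in _ + k](size_segment word j); apply: (IH (seg j k) _ false) => //.
    by rewrite size_segment.
  split; rewrite /occurs ?size_segment /= ?andbT ?eqxx ?eq_u //.
  move=> x lt_x; rewrite andbT; apply/negP=> /eqP eq_x; rewrite -eq_u in eq_x.
  by have := between x lt_x eq_x; rewrite !all_ext ?word_lt3.
(* Exactly the occurrences between nonzero letters lift, whence the flagged induction hypothesis. *)
- rewrite !nz_ext ?word_lt3 // in ext1 ext2 ext1' ext2'.
  rewrite -[k in _ + k](size_segment word j); apply: (IH (seg j k) _ true) => //.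
    by rewrite size_segment.
  split; rewrite /occurs ?size_segment /= ?eqxx ?j_gt0 ?ext1 ?eq_u ?eqxx ?j'_gt0 ?ext1' //.
  move=> x lt_x; rewrite -eq_u.
  apply/negP=> /and4P [/eqP eq_x x_gt0 e1 e2].
  by have := between x lt_x eq_x; rewrite !nz_ext ?word_lt3 // e1 e2.
rewrite !one_ext ?word_lt3 // in ext2 ext1' ext2'.
set a := word j.-1 in one_ext ext2 ext1' ext2'.
(* All images begin with 10, so [[:: 1]] cannot single out one letter. With two letters in [t], the
   word [v'] below, which frames [seg j k] by [a], is still shorter than [v]. *)
have t_gt1 : 1 < size t.
  rewrite ltn_neqAle t_gt0 andbT eq_sym; apply/eqP=> t_eq1.
  have def_t : t = [:: 1] by case: (t) t1 t_eq1 => [|x []] //= ->.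
  have e0 := one_ext 0 isT; have e1 := one_ext 1 isT; have e2 := one_ext 2 isT.
  have same c : extends b [:: 1] c = extends b [:: 1] 0.
    by case: (b) c => [] [|[]].
  rewrite def_t in e0 e1 e2; rewrite same e0 in e1; rewrite same e0 in e2.
  by have := word_lt3 j.-1; rewrite -/a; case: (a) e1 e2 => [|[|[]]].
have wrap x l : 0 < x -> seg x.-1 l.+2 = word x.-1 :: rcons (seg x l) (word (x + l)).
  by move=> x_gt0; rewrite -addn1 segmentD segmentS prednK // -cats1 /= addnS -addSn prednK.
pose v' := a :: rcons (seg j k) a.
have pal_v' : palindrome v'.
  by rewrite /palindrome rev_cons rev_rcons (eqP pal_u).
have sz_v' : size v' = k.+2 by rewrite /= size_rcons size_segment.
have : palindrome (seg j.-1 (j'.-1 - j.-1 + size v')).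
  apply: (IH v' _ false) => //; first by rewrite sz_v'; clear -sz_v le_n t_gt1; lia.
  split; rewrite /occurs ?sz_v' ?andbT; first by clear -j_gt0 lt_jj; lia.
  - by rewrite wrap // (eqP ext2).
  - by rewrite wrap // -eq_u (eqP ext1') (eqP ext2').
  move=> x lt_x; rewrite andbT; apply/negP=> /eqP eq_x.
  have := wrap x.+1 k isT; rewrite /= eq_x => - [eq_a].
  move/eqP; rewrite eqseq_rcons => /andP [/eqP eq_s /eqP eq_b].
  have := between x.+1; rewrite -eq_s => /(_ _ erefl).
  rewrite !one_ext ?word_lt3 //= -eq_a -eq_b eqxx => H.
  by suff: false by []; apply: H; clear -j_gt0 lt_x; lia.
rewrite sz_v'; have -> : j'.-1 - j.-1 + k.+2 = (j' - j + k).+2.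
  by clear -j_gt0 lt_jj; lia.
rewrite wrap // /palindrome rev_cons rev_rcons -cats1 cat_cons cats1.
by rewrite eqseq_cons eqseq_rcons => /and3P [].
Qed.

Section Richness.
Variable T : eqType.
Implicit Types (u v y z : seq T) (a : T).

Lemma infix_rcons u z a : infix u (rcons z a) = infix u z || suffix u (rcons z a).
Proof.
apply/idP/orP => [/infixP [p [q]]|[/infixP [p [q ->]]|/suffixP [p ->]]].
- case: (lastP q) => [|q' b]; first by rewrite cats0 => ->; right; apply: suffix_suffix.
  rewrite -!rcons_cat => /eqP; rewrite eqseq_rcons => /andP [/eqP -> _]; left.
  exact: infix_infix.
- by rewrite -cats1 -!catA infix_infix.
- by apply/infixP; exists p, [::]; rewrite cats0.
Qed.

(** Being a suffix of the palindrome [v], [u] is also a proper prefix of it, and that copy ends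
    before the last letter [a]. *)
Lemma shorter_palindrome_infix u v z a :
  palindrome u -> palindrome v -> suffix u (rcons z a) -> suffix v (rcons z a) ->
  size u < size v -> infix u z.
Proof.
move=> /eqP pal_u /eqP pal_v /suffixP [p def_p] /suffixP [q def_q] lt_uv.
have [r def_v] : exists r, v = r ++ u.
  exists (take (size v - size u) v); rewrite -{1}[v](cat_take_drop (size v - size u)).
  congr (_ ++ _); have := congr1 (fun s => drop (size s - size u) s) (esym def_p).
  rewrite size_cat addnK drop_size_cat // def_q size_cat -addnBA ?(ltnW lt_uv) //.
  by rewrite drop_cat ltnNge leq_addr addKn.
have {}def_v : v = u ++ rev r by rewrite -pal_v def_v rev_cat pal_u.
case: (lastP (rev r)) def_v => [|s b] def_v; first by rewrite def_v cats0 ltnn in lt_uv.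
move/eqP: def_q; rewrite def_v -!rcons_cat eqseq_rcons => /andP [/eqP -> _].
exact: infix_infix.
Qed.

(** Appending a letter creates at most one new palindrome, since all palindromic suffixes but the
    longest occurred before; if each letter creates one, the count is exact. *)
Lemma rich_of_new_palindromes y :
  (forall z a, prefix (rcons z a) y ->
    exists v, [/\ palindrome v, suffix v (rcons z a) & ~~ infix v z]) ->
  rich y.
Proof.
elim/last_ind: y => [|z a IH] new //.
have rich_z : rich z.
  by apply: IH => z' a' pre; apply: new; apply: prefix_trans pre (prefix_rcons _ _).
have [v [pal_v suf_v notin_v]] := new z a (prefix_refl _).
rewrite /rich size_rcons -rich_z -/(size (v :: [seq y <- factors z | palindrome y])).
apply/perm_size/uniq_perm; rewrite ?cons_uniq ?filter_uniq ?undup_uniq //.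
  by rewrite andbT mem_filter mem_factors (negbTE notin_v) andbF.
move=> u; rewrite inE !mem_filter !mem_factors infix_rcons.
apply/andP/predU1P => [[pal_u /orP [in_u|suf_u]]|[->|/andP [-> ->]]] //.
- by right; rewrite pal_u.
- have [lt_uv|lt_vu|eq_uv] := ltngtP (size u) (size v).
  + by right; rewrite pal_u (shorter_palindrome_infix pal_u pal_v suf_u suf_v).
  + by case/negP: notin_v; apply: shorter_palindrome_infix suf_v suf_u lt_vu.
  left; have /suffixP [p def_p] := suf_u; have /suffixP [q def_q] := suf_v.
  have := congr1 size def_q; rewrite def_p !size_cat eq_uv => /eqP.
  rewrite eqn_add2r => /eqP eq_pq; move/eqP: def_q.
  by rewrite def_p eqseq_cat // => /andP [_ /eqP].
- by rewrite suf_v orbT.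
Qed.

(** The longest palindromic suffix of each prefix of [y] is new: otherwise its latest earlier
    occurrence starts a complete return, which is a longer palindromic suffix. *)
Lemma inf_rich_of_returns (w : infinite_word T) :
  (forall v i i', palindrome v ->
     consecutive (fun k => segment w k (size v) == v) i i' ->
     palindrome (segment w i (i' - i + size v))) ->
  inf_rich w.
Proof.
move=> returns y [m [n ->]]; rewrite mkseq_segment; apply: rich_of_new_palindromes => z a pre.
have [l def_z] : exists l, rcons z a = segment w m l.+1.
  exists (size z); have sz := size_prefix pre; rewrite size_segment size_rcons in sz.
  move: pre; rewrite prefixE size_rcons take_segment // => /eqP; first exact: esym.
pose suf k := segment w (m + l.+1 - k) k.
have ex_k : exists k, (0 < k <= l.+1) && palindrome (suf k).
  by exists 1; apply/andP; split=> //; apply: eqxx.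
have ub_k k : (0 < k <= l.+1) && palindrome (suf k) -> k <= l.+1 by case/andP=> /andP [].
have [k /andP [/andP [k_gt0 le_k] pal_k] max_k] := ex_maxnP ex_k ub_k.
have def_zs : z = segment w m l.
  have := congr1 (take l) def_z; rewrite take_segment //.
  have sz : size z = l by have := congr1 size def_z; rewrite size_rcons size_segment => -[].
  by rewrite -cats1 -sz take_size_cat.
exists (suf k); split=> //.
  apply/suffixP; exists (segment w m (l.+1 - k)).
  by rewrite def_z -[in LHS](subnK le_k) segmentD addnBA.
apply/negP=> /infixP [p [q def_pq]].
have sz_pq : l = size p + (k + size q).
  by have := congr1 size def_pq; rewrite def_zs !size_cat !size_segment.
pose P i := segment w i (size (suf k)) == suf k.
pose i' := m + l.+1 - k.
have P_i' : P i' by rewrite /P size_segment.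
have P_i : P (m + size p).
  rewrite /P size_segment; have := congr1 (fun s => take k (drop (size p) s)) def_pq.
  rewrite /= drop_size_cat // take_size_cat ?size_segment // def_zs drop_segment take_segment.
    by move/eqP.
  by rewrite sz_pq addKn leq_addr.
have ex_i : exists i, (m <= i < i') && P i.
  by exists (m + size p); rewrite P_i leq_addr andbT /i'; lia.
have ub_i i : (m <= i < i') && P i -> i <= i' by case/andP=> /andP [_ /ltnW].
have [i /andP [/andP [le_mi lt_ii] {}P_i] max_i] := ex_maxnP ex_i ub_i.
have := returns (suf k) i i' pal_k; rewrite !size_segment => pal_ret.
have /max_k : (0 < i' - i + k <= l.+1) && palindrome (suf (i' - i + k)).
  rewrite {1}/i'; apply/andP; split; first by lia.
  have -> : suf (i' - i + k) = segment w i (i' - i + k).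
    by congr segment; rewrite /i'; lia.
  apply: pal_ret; split=> //; rewrite -/(suf k).
    by move: P_i; rewrite /P size_segment.
  move=> x /andP [lt_ix lt_xi].
  apply/negP=> P_x; have := max_i x; rewrite lt_xi /P size_segment P_x andbT.
  by rewrite (leq_trans le_mi (ltnW lt_ix)) leqNgt lt_ix => /(_ isT).
by lia.
Qed.
End Richness.

(** * Templates of additive fourth powers *)

Local Arguments Z.add : simpl never.
Local Arguments Z.sub : simpl never.
Local Arguments Z.mul : simpl never.

Definition vec := (Z * Z)%type.

Definition point (x : nat) : vec := (Z.of_nat x, Z.of_nat (sumn (seg 0 x))).

Definition digit (a c : nat) : vec := (Z.of_nat c, Z.of_nat (sumn (take c (block a)))).

Definition lift (v : vec) : vec := (5 * v.1 + 2 * v.2, 2 * v.1 + 4 * v.2)%Z.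

Definition vadd (u v : vec) : vec := (u.1 + v.1, u.2 + v.2)%Z.

Definition bend (p q r : vec) : vec := (p.1 - 2 * q.1 + r.1, p.2 - 2 * q.2 + r.2)%Z.

(* The inverse of [lift], whose matrix has determinant 16. *)
Definition unlift (v : vec) : option vec :=
  let x := (4 * v.1 - 2 * v.2)%Z in let y := (5 * v.2 - 2 * v.1)%Z in
  if (x mod 16 =? 0)%Z then if (y mod 16 =? 0)%Z then Some (x / 16, y / 16)%Z else None
  else None.

Definition state := ((nat * nat * nat * nat * nat) * (vec * vec * vec))%type.

Definition state_at (x0 x1 x2 x3 x4 : nat) : state :=
  ((word x0, word x1, word x2, word x3, word x4),
   (bend (point x0) (point x1) (point x2), bend (point x1) (point x2) (point x3),
    bend (point x2) (point x3) (point x4))).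

Definition digits (a : nat) : seq (nat * vec) :=
  [seq (b, digit b c) | b <- [:: 0; 1; 2],
     c <- [seq c <- iota 0 (size (block b)) | nth 0 (block b) c == a]].

Definition vsub (u v : vec) : vec := (u.1 - v.1, u.2 - v.2)%Z.

(** Each letter is placed at every possible offset in every image. Subtracting the second
    differences of the offsets must leave a vector in the image of [lift]; testing this as soon as
    three positions are chosen prunes the search. *)
Definition parents (s : state) : seq state :=
  let '((a0, a1, a2, a3, a4), (d1, d2, d3)) := s in
  let q1 := digits a1 in let q2 := digits a2 in
  let q3 := digits a3 in let q4 := digits a4 in
  flatten [seq flatten [seq flatten [seq
    if unlift (vsub d1 (bend p0.2 p1.2 p2.2)) is Some v1 then
      flatten [seq
        if unlift (vsub d2 (bend p1.2 p2.2 p3.2)) is Some v2 then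
          pmap (fun p4 =>
            if unlift (vsub d3 (bend p2.2 p3.2 p4.2)) is Some v3 then
              Some ((p0.1, p1.1, p2.1, p3.1, p4.1), (v1, v2, v3))
            else None) q4
        else [::] | p3 <- q3]
    else [::] | p2 <- q2] | p1 <- q1] | p0 <- digits a0].

Definition table := seq (seq (vec * vec * vec)).

(* Tables are indexed by the base 3 code of the five letters of a state. *)
Definition bucket (t : table) (l : nat * nat * nat * nat * nat) : seq (vec * vec * vec) :=
  let '(a0, a1, a2, a3, a4) := l in nth [::] t (a0 + 3 * (a1 + 3 * (a2 + 3 * (a3 + 3 * a4)))).

Definition in_table (t : table) (s : state) : bool := s.2 \in bucket t s.1.

Definition insert (t : table) (s : state) : table :=
  let '(a0, a1, a2, a3, a4) := s.1 in
  set_nth [::] t (a0 + 3 * (a1 + 3 * (a2 + 3 * (a3 + 3 * a4)))) (s.2 :: bucket t s.1).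

Fixpoint explore (fuel : nat) (t : table) (todo : seq state) : table :=
  if fuel is fuel'.+1 then
    if todo is s :: todo' then
      if in_table t s then explore fuel' t todo'
      else explore fuel' (insert t s) (parents s ++ todo')
    else t
  else t.

Definition letter_tuples : seq (nat * nat * nat * nat * nat) :=
  let letters := [:: 0; 1; 2] in
  [seq (p, a) | p <- [seq (p, a) | p <- [seq (p, a) | p <- [seq (p, a) |
    p <- letters, a <- letters], a <- letters], a <- letters], a <- letters].

Definition roots : seq state :=
  [seq (l, ((0, 0), (0, 0), (0, 0))%Z) | l <- letter_tuples].

(* The fuel suffices because [check_reachable] verifies that the result is closed. *)
Definition reachable : table := explore 4000 [::] roots.

Definition closed_table (t : table) : bool :=
  all (fun l => all (fun d => all (in_table t) (parents (l, d))) (bucket t l)) letter_tuples.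

Definition state_in (u : seq nat) (c0 c1 c2 c3 c4 : nat) : state :=
  let p c : vec := (Z.of_nat c, Z.of_nat (sumn (take c u))) in
  let a := nth 0 u in
  ((a c0, a c1, a c2, a c3, a c4),
   (bend (p c0) (p c1) (p c2), bend (p c1) (p c2) (p c3), bend (p c2) (p c3) (p c4))).

(* Five positions with the same block index, or straddling one boundary by a single
   letter, are the only ones that do not get closer under desubstitution. *)
Definition trivial_in (t : table) (u : seq nat) : bool :=
  let n := size u in
  all (fun c0 => all (fun c1 => all (fun c2 => all (fun c3 => all (fun c4 =>
    if in_table t (state_in u c0 c1 c2 c3 c4) then c0 == c4 else true)
  (iota c3 (n - c3))) (iota c2 (n - c2))) (iota c1 (n - c1))) (iota c0 (n - c0))) (iota 0 n).

Definition check_table (t : table) : bool :=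
  [&& all (in_table t) roots, closed_table t &
      all (trivial_in t) [:: block 0; block 1; block 2; [:: 1; 1]]].

Lemma check_reachable : check_table reachable.
Proof. by vm_cast_no_check (erefl true). Qed.

Lemma pointD x n : point (x + n) = vadd (point x) (Z.of_nat n, Z.of_nat (sumn (seg x n))).
Proof. by rewrite /point segmentD sumn_cat add0n /vadd /=; congr pair; lia. Qed.

Lemma sizes_morph (u : seq nat) : all (gtn 3) u ->
  size (morph u) = 5 * size u + 2 * sumn u /\ sumn (morph u) = 2 * size u + 4 * sumn u.
Proof.
elim: u => // a u IH /= /andP [lt_a /IH [IHs IHm]].
rewrite morph_cons size_cat sumn_cat IHs IHm.
case: a lt_a => [|[|[|]]] //= _; split; clear; lia.
Qed.

Lemma point_cut y c : c < size (block (word y)) ->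
  point (cut y + c) = vadd (lift (point y)) (digit (word y) c).
Proof.
move=> lt_c; have [sz sm] := sizes_morph (seg_lt3 0 y); rewrite size_segment in sz sm.
rewrite /point segmentD sumn_cat add0n segment_cut0 -(take_segment _ _ (ltnW lt_c)).
rewrite segment_block sm -[cut y]/(size (morph (seg 0 y))) sz /vadd /lift /digit /=.
by congr pair; lia.
Qed.

Lemma unlift_lift v : unlift (lift v) = Some v.
Proof.
case: v => a b; rewrite /unlift /lift /=.
have -> : (4 * (5 * a + 2 * b) - 2 * (2 * a + 4 * b) = a * 16)%Z by lia.
have -> : (5 * (2 * a + 4 * b) - 2 * (5 * a + 2 * b) = b * 16)%Z by lia.
by rewrite !Z.mod_mul // !Z.div_mul.
Qed.

(** [bend] is linear, so it commutes with [lift] and the offsets separate out. *)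
Lemma unlift_bend p q r d e f :
  unlift (vsub (bend (vadd (lift p) d) (vadd (lift q) e) (vadd (lift r) f)) (bend d e f)) =
  Some (bend p q r).
Proof.
rewrite -unlift_lift; congr unlift; case: p q r d e f => [? ?] [? ?] [? ?] [? ?] [? ?] [? ?].
by rewrite /vsub /bend /vadd /lift /=; congr pair; lia.
Qed.

Lemma mem_digits y c : c < size (block (word y)) ->
  (word y, digit (word y) c) \in digits (word (cut y + c)).
Proof.
move=> lt_c; apply/allpairsPdep; exists (word y), c; split=> //.
  by have := word_lt3 y; case: (word y) => [|[|[|]]].
by rewrite mem_filter mem_iota lt_c nth_block // eqxx.
Qed.

Lemma mem_parents y0 y1 y2 y3 y4 c0 c1 c2 c3 c4 :
  c0 < size (block (word y0)) -> c1 < size (block (word y1)) ->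
  c2 < size (block (word y2)) -> c3 < size (block (word y3)) ->
  c4 < size (block (word y4)) ->
  state_at y0 y1 y2 y3 y4 \in
    parents (state_at (cut y0 + c0) (cut y1 + c1) (cut y2 + c2) (cut y3 + c3) (cut y4 + c4)).
Proof.
move=> lt0 lt1 lt2 lt3 lt4; rewrite /parents {2}/state_at !point_cut //.
apply/flatten_mapP; exists (word y0, digit (word y0) c0); first exact: mem_digits.
apply/flatten_mapP; exists (word y1, digit (word y1) c1); first exact: mem_digits.
apply/flatten_mapP; exists (word y2, digit (word y2) c2); first exact: mem_digits.
rewrite unlift_bend.
apply/flatten_mapP; exists (word y3, digit (word y3) c3); first exact: mem_digits.
rewrite unlift_bend mem_pmap; apply/mapP.
by exists (word y4, digit (word y4) c4); [exact: mem_digits | rewrite unlift_bend].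
Qed.

(** Second differences are invariant under translation, so within a known factor a state depends
    only on the offsets. *)
Lemma state_at_in x u c0 c1 c2 c3 c4 : seg x (size u) = u ->
  c0 < size u -> c1 < size u -> c2 < size u -> c3 < size u -> c4 < size u ->
  state_at (x + c0) (x + c1) (x + c2) (x + c3) (x + c4) = state_in u c0 c1 c2 c3 c4.
Proof.
move=> def_u lt0 lt1 lt2 lt3 lt4.
have point_x c : c < size u ->
    point (x + c) = vadd (point x) (Z.of_nat c, Z.of_nat (sumn (take c u))).
  by move=> lt_c; rewrite pointD -[in RHS]def_u take_segment // ltnW.
have word_x c : c < size u -> word (x + c) = nth 0 u c.
  by move=> lt_c; rewrite -[in RHS]def_u nth_segment.
have bend_add p d e f : bend (vadd p d) (vadd p e) (vadd p f) = bend d e f.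
  by rewrite /bend /vadd /=; congr pair; lia.
by rewrite /state_at /state_in !point_x // !word_x // !bend_add.
Qed.

Lemma mem_letter_tuples x0 x1 x2 x3 x4 :
  (word x0, word x1, word x2, word x3, word x4) \in letter_tuples.
Proof.
have in_letters x : word x \in [:: 0; 1; 2] by have := word_lt3 x; case: (word x) => [|[|[|]]].
by do 4 ![apply: (@allpairs_f _ _ _ (fun p a => (p, a))) => //].
Qed.

Lemma trivial_inP t u c0 c1 c2 c3 c4 : trivial_in t u ->
  c0 <= c1 -> c1 <= c2 -> c2 <= c3 -> c3 <= c4 -> c4 < size u ->
  in_table t (state_in u c0 c1 c2 c3 c4) -> c0 = c4.
Proof.
move=> triv le0 le1 le2 le3 lt4 in_t.
have in_iota a c : a <= c -> c < size u -> c \in iota a (size u - a).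
  by rewrite mem_iota => -> lt_c /=; lia.
have lt3 := leq_ltn_trans le3 lt4; have lt2 := leq_ltn_trans le2 lt3.
have lt1 := leq_ltn_trans le1 lt2; have lt0 := leq_ltn_trans le0 lt1.
have in0 := in_iota 0 c0 isT lt0; rewrite subn0 in in0.
have := allP (allP (allP (allP (allP triv _ in0) _ (in_iota _ _ le0 lt1))
  _ (in_iota _ _ le1 lt2)) _ (in_iota _ _ le2 lt3)) _ (in_iota _ _ le3 lt4).
by rewrite in_t => /eqP.
Qed.

(** Induction on [x4 - x0]. The block indices form a parent state, again in the closed table. Either
    they are closer together, or all five positions lie in one image or in a factor 11, where
    [trivial_in] applies. *)
Lemma table_trivial t x0 x1 x2 x3 x4 : check_table t ->
  x0 <= x1 -> x1 <= x2 -> x2 <= x3 -> x3 <= x4 ->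
  in_table t (state_at x0 x1 x2 x3 x4) -> x0 = x4.
Proof.
move=> /and3P [_ closed /allP triv]; have [n le_n] := ubnP (x4 - x0).
elim: n => // n IH in x0 x1 x2 x3 x4 le_n *.
move=> le0 le1 le2 le3 in_s.
have triv_in x u c0 c1 c2 c3 c4 : u \in [:: block 0; block 1; block 2; [:: 1; 1]] ->
    seg x (size u) = u -> x0 = x + c0 -> x1 = x + c1 -> x2 = x + c2 -> x3 = x + c3 ->
    x4 = x + c4 -> c4 < size u -> x0 = x4.
  move=> in_u def_u def0 def1 def2 def3 def4 lt4.
  move: le0 le1 le2 le3; rewrite def0 def1 def2 def3 def4 !leq_add2l => le0' le1' le2' le3'.
  have lt3 := leq_ltn_trans le3' lt4; have lt2 := leq_ltn_trans le2' lt3.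
  have lt1 := leq_ltn_trans le1' lt2; have lt0 := leq_ltn_trans le0' lt1.
  congr (_ + _); apply: (@trivial_inP t u c0 c1 c2 c3 c4) => //; first exact: triv.
  by rewrite -(state_at_in def_u) // -def0 -def1 -def2 -def3 -def4.
have [y0 [c0 [def0 lt0]]] := cutP x0; have [y1 [c1 [def1 lt1]]] := cutP x1.
have [y2 [c2 [def2 lt2]]] := cutP x2; have [y3 [c3 [def3 lt3]]] := cutP x3.
have [y4 [c4 [def4 lt4]]] := cutP x4.
have in_blocks y : block (word y) \in [:: block 0; block 1; block 2; [:: 1; 1]].
  by have := word_lt3 y; case: (word y) => [|[|[|]]].
have mono_cut y z c d : cut y + c <= cut z + d -> d < size (block (word z)) -> y <= z.
  by move=> le_yz lt_d; rewrite leqNgt -leq_cut cutS; lia.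
have le_y0 : y0 <= y1 by apply: (mono_cut y0 y1 c0 c1) lt1; rewrite -def0 -def1.
have le_y1 : y1 <= y2 by apply: (mono_cut y1 y2 c1 c2) lt2; rewrite -def1 -def2.
have le_y2 : y2 <= y3 by apply: (mono_cut y2 y3 c2 c3) lt3; rewrite -def2 -def3.
have le_y3 : y3 <= y4 by apply: (mono_cut y3 y4 c3 c4) lt4; rewrite -def3 -def4.
have [eq_y|ne_y] := eqVneq y0 y4.
  have [e1 [e2 e3]] : y1 = y0 /\ y2 = y0 /\ y3 = y0.
    by clear -le_y0 le_y1 le_y2 le_y3 eq_y; lia.
  subst y1 y2 y3 y4.
  exact: (triv_in (cut y0) (block (word y0))) (segment_block y0) def0 def1 def2 def3 def4 lt4.
have in_parents : in_table t (state_at y0 y1 y2 y3 y4).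
  have := allP (allP (allP closed _ (mem_letter_tuples x0 x1 x2 x3 x4)) _ in_s).
  by apply; rewrite -/(state_at x0 x1 x2 x3 x4) def0 def1 def2 def3 def4 mem_parents.
have lt_y : y0 < y4 by rewrite ltn_neqAle ne_y; lia.
have [lt_d|ge_d] := ltnP (y4 - y0) (x4 - x0).
  have lt_n : y4 - y0 < n by apply: leq_trans lt_d _.
  by rewrite (IH _ _ _ _ _ lt_n le_y0 le_y1 le_y2 le_y3 in_parents) eqxx in ne_y.
(* Every image strictly between those of [x0] and [x4] adds at least 5 to their distance, so without
   shrinking [x0] and [x4] are the two letters of 11 at one boundary. *)
have cut_y : cut y0.+1 <= cut y4 by rewrite leq_cut.
have ge5 : 5 * (y4 - y0.+1) <= cut y4 - cut y0.+1.
  rewrite -[in cut y4](subnKC lt_y) cutD addKn.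
  by have := size_morph_ge (seg y0.+1 (y4 - y0.+1)); rewrite size_segment.
have def_y4 : y4 = y0.+1 by rewrite cutS in cut_y ge5; lia.
have eq_x0 : x0 = (cut y4).-1 by rewrite def_y4 cutS; rewrite def_y4 cutS in def4 ge_d; lia.
have y4_gt0 : 0 < y4 by rewrite def_y4.
have cut_y4 := cut_gt0 y4_gt0; have eq_x4 : x4 = cut y4 by lia.
have def_u : seg x0 2 = [:: 1; 1].
  by rewrite segmentS eq_x0 prednK ?segmentS ?word_cut ?word_cut_pred //; lia.
apply: (triv_in x0 [:: 1; 1] 0 (x1 - x0) (x2 - x0) (x3 - x0) (x4 - x0)) => //=; lia.
Qed.

Lemma sum_Posz (u : seq nat) : word_sum (map Posz u) = Posz (sumn u).
Proof.
by rewrite /word_sum big_map; elim: u => [|a u IH]; rewrite ?big_nil ?big_cons //= IH.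
Qed.

Lemma in_reachable_root x0 x1 x2 x3 x4 :
  bend (point x0) (point x1) (point x2) = (0, 0)%Z ->
  bend (point x1) (point x2) (point x3) = (0, 0)%Z ->
  bend (point x2) (point x3) (point x4) = (0, 0)%Z ->
  in_table reachable (state_at x0 x1 x2 x3 x4).
Proof.
move=> e1 e2 e3; have := check_reachable; rewrite /check_table => /and3P [/allP root _ _].
apply: root; rewrite /state_at e1 e2 e3; apply: map_f; exact: mem_letter_tuples.
Qed.

(** Equal lengths and sums make the five endpoints of the blocks an arithmetic progression in
    coordinates, so the second differences vanish and the first and last endpoints coincide. *)
Lemma word_no_additive_4power m l :
  (forall i, i < 4 -> sumn (seg (m + i * l) l) = sumn (seg m l)) -> l = 0.
Proof.
move=> eq_sum; set s := sumn (seg m l) in eq_sum.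
have step i : i < 4 ->
    point (m + i.+1 * l) = vadd (point (m + i * l)) (Z.of_nat l, Z.of_nat s).
  by move=> lt_i; rewrite mulSnr addnA pointD eq_sum.
have bend0 p v : bend p (vadd p v) (vadd (vadd p v) v) = (0, 0)%Z.
  by rewrite /bend /vadd /=; congr pair; lia.
have := @table_trivial reachable (m + 0 * l) (m + 1 * l) (m + 2 * l) (m + 3 * l)
  (m + 4 * l) check_reachable.
rewrite in_reachable_root; first by lia.
- by rewrite (step 1) // (step 0).
- by rewrite (step 2) // (step 1).
- by rewrite (step 3) // (step 2).
Qed.

(** * Transfer to integer letters and conclusion *)

Definition int_word : infinite_word int := fun i => Posz (word i).

Lemma segment_int_word i n : segment int_word i n = map Posz (seg i n).
Proof. by rewrite /segment -map_comp. Qed.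

Lemma Posz_inj : injective Posz.
Proof. by move=> a b []. Qed.

Lemma int_word_rich : inf_rich int_word.
Proof.
apply: inf_rich_of_returns => v i i' pal_v [lt_ii /eqP occ_i occ_i' none].
pose u := seg i (size v); have def_v : v = map Posz u by rewrite -segment_int_word.
have sz_u : size u = size v by rewrite size_segment.
have pal_map s : palindrome (map Posz s) = palindrome s.
  by rewrite /palindrome -map_rev (eqtype.inj_eq (inj_map Posz_inj)).
rewrite segment_int_word pal_map; rewrite def_v pal_map in pal_v.
have occE k : occurs false u k = (segment int_word k (size v) == v).
  rewrite /occurs andbT sz_u segment_int_word.
  by rewrite -(eqtype.inj_eq (inj_map Posz_inj)) -def_v.
have := @palindromic_returns false u i i' pal_v; rewrite sz_u; apply.
split=> //; rewrite ?occE // ?occ_i //.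
by move=> k /none; rewrite occE.
Qed.

Lemma int_word_additive_4power_free : inf_additive_power_free 4 int_word.
Proof.
move=> y [m [n ->]]; rewrite mkseq_segment.
case=> -[[|v0 [|v1 [|v2 [|v3 []]]]] //= sz_ws] [/= def_y nonempty same].
have in_ws i : i < 4 ->
    nth [::] [:: v0; v1; v2; v3] i \in @Tuple 4 _ [:: v0; v1; v2; v3] sz_ws.
  by move=> lt_i; apply: (mem_nth [::]).
set l := size v0.
have sz_v i : i < 4 -> size (nth [::] [:: v0; v1; v2; v3] i) = l.
  by move=> lt_i; have [] := same _ _ (in_ws i lt_i) (in_ws 0 isT).
have def_n : n = l + (l + (l + l)).
  have := congr1 size def_y; rewrite !size_cat size_segment /= addn0.
  by rewrite (sz_v 1 isT) (sz_v 2 isT) (sz_v 3 isT).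
have def_v i : i < 4 -> nth [::] [:: v0; v1; v2; v3] i = map Posz (seg (m + i * l) l).
  move: def_y; rewrite def_n !segmentD cats0 => /eqP.
  rewrite !eqseq_cat ?size_segment ?(sz_v 1 isT) ?(sz_v 2 isT) //.
  case/and4P=> /eqP e0 /eqP e1 /eqP e2 /eqP e3.
  case: i => [|[|[|[|]]]] //= _; rewrite -segment_int_word.
  - by rewrite mul0n addn0.
  - by rewrite mul1n.
  - by rewrite -e2; congr segment; lia.
  - by rewrite -e3; congr segment; lia.
have l0 : l = 0.
  apply: (@word_no_additive_4power m) => i lt_i; apply: Posz_inj.
  rewrite -!sum_Posz -def_v //; have [_ ->] := same _ _ (in_ws i lt_i) (in_ws 0 isT).
  by rewrite (def_v 0 isT) mul0n addn0.
by case: (nonempty v0 (in_ws 0 isT)); apply/nilP; rewrite /nilp -/l l0.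
Qed.

Local Open Scope ring_scope.

Theorem theorem1p2 :
  exists w : infinite_word int,
    [/\ forall i : nat, w i \in [:: 0; 1; 2],
        inf_rich w &
        inf_additive_power_free 4 w].
Proof.
exists int_word; split; [|exact: int_word_rich|exact: int_word_additive_4power_free].
by move=> i; have := word_lt3 i; rewrite /int_word; case: (word i) => [|[|[|]]].
Qed.
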